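(* Work in the setting of the context. Suppose there are $\beta\in\,]0,1]$ and a square $\mathbb P^Z$-integrable strictly positive mapping $C:\mathbb R^d\to\,]0,\infty[$ with $$|G(\theta,z)-G(\vartheta,z)|\le C(z)\,\|\theta-\vartheta\|_m^\beta\qquad\text{for all }z\in\mathbb R^d,\ \theta,\vartheta\in\Theta.$$ Suppose further that $G(\theta,\cdot)$ is Borel measurable for every $\theta\in\Theta$ and that $G(\overline\theta,\cdot)$ is square $\mathbb P^Z$-integrable for some $\overline\theta\in\Theta$. Then: 1) $\xi^G:=C(\cdot)\,\Delta(\Theta)^\beta+|G(\overline\theta,\cdot)|$ is a positive square $\mathbb P^Z$-integrable envelope of $\mathbb F^\Theta$ with $$J(\mathbb F^\Theta,\xi^G,\varepsilon)\le2\varepsilon\sqrt{(3m+1)\ln(2)+\tfrac m\beta\ln(2/\varepsilon)}\qquad\text{for }\varepsilon\in\,]0,1/2].$$ In particular, for every $\delta>0$ and every at most countable dense subset $\mathcal C(\mathcal U_\delta)$ of $\mathcal U_\delta$ there are $(\mathbb P^Z)^n$-null sets $N_n^\delta$ ($n\in\mathbb N$) such that $\inf_{\vartheta\in\mathcal C(\mathcal U_\delta)}\{\mathbb E[|G(\theta,Z_1)-G(\vartheta,Z_1)|]+\max_{1\le j\le n}|G(\theta,z_j)-G(\vartheta,z_j)|\}=0$ for all $\theta\in\mathcal U_\delta$, $n\in\mathbb N$ and $(z_1,\dots,z_n)\in\mathbb R^{dn}\setminus N_n^\delta$. 2) For every $\delta>0$, $\xi^G_\delta:=C(\cdot)\,2^\beta\delta^\beta$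 is a positive square $\mathbb P^Z$-integrable envelope of $\mathbb F^\Theta_\delta$ with $$J(\mathbb F^\Theta_\delta,\xi^G_\delta,\varepsilon)\le2\varepsilon\sqrt{(3m+1)\ln(2)+\tfrac m\beta\ln(2/\varepsilon)}\qquad\text{for }\varepsilon\in\,]0,1/2].$$
   Context: $\Theta\subset\mathbb R^m$ is compact with Euclidean diameter $\Delta(\Theta)>0$; $\|\cdot\|_m$ is the Euclidean norm; $G:\Theta\times\mathbb R^d\to\mathbb R$; $Z_1$ is a $d$-dimensional random vector with distribution $\mathbb P^Z$. $\theta^*\in\Theta$ is a fixed point (in the paper, the unique solution of the stochastic program under study). $\mathcal U_\delta:=\{\theta\in\Theta:\|\theta-\theta^*\|_m\le\delta\}$; $\mathbb F^\Theta:=\{G(\theta,\cdot):\theta\in\Theta\}$; $\mathbb F^\Theta_\delta:=\{G(\theta,\cdot)-G(\theta^*,\cdot):\theta\in\mathcal U_\delta\}$. A positive envelope of a class $\mathbb F$ of Borel functions on $\mathbb R^d$ is a strictly positive Borel function $C_{\mathbb F}$ with $\sup_{h\in\mathbb F}|h|\le C_{\mathbb F}$. $\|f\|_{\mathbb Q,2}=(\int f^2d\mathbb Q)^{1/2}$. $N(\eta,\mathbb F,L^2(\mathbb Q))$ is the minimal number of closed $L^2(\mathbb Q)$-balls of radius $\eta$ with centers in $\mathbb F$ needed to cover $\mathbb F$ ($\infty$ if no finite cover exists). $\mathcal M_{\rm fin}$ is the set of probability measures on $\mathcal B(\mathbb R^d)$ with finite support. $J(\mathbb F,C_{\mathbb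 F},\delta):=\int_0^\delta\sup_{\mathbb Q\in\mathcal M_{\rm fin}}\sqrt{\ln\big(2N(\varepsilon\|C_{\mathbb F}\|_{\mathbb Q,2},\mathbb F,L^2(\mathbb Q))\big)}\,d\varepsilon$. *)

(* Defs.v *)
(* MathComp-Analysis.  Conventions:
   - R^m, the parameter space, is 'rV[R]_m with its library topology; as the
     library norm on matrices is the sup norm, the Euclidean norm is enorm below;
   - R^d, the sample space, is d.-tuple R, whose library sigma-algebra (generated
     by the coordinates) is the Borel sigma-algebra, and (R^d)^n is
     n.-tuple (d.-tuple R);
   - "square P-integrable" is membership in Lfun P 2%:E, which includes
     measurability. *)
From HB Require Import structures.
From mathcomp Require Import all_boot all_order all_algebra.
From mathcomp Require Import all_classical all_reals all_analysis.

Set Implicit Arguments.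
Unset Strict Implicit.
Unset Printing Implicit Defensive.

Import Order.TTheory GRing.Theory Num.Theory.
Import numFieldNormedType.Exports.

Local Open Scope classical_set_scope.
Local Open Scope ring_scope.

Section euclidean.
Context {R : realType} {m : nat}.

Definition enorm (x : 'rV[R]_m) : R := Num.sqrt (\sum_(i < m) x ord0 i ^+ 2).

(* Meaningful for bounded nonempty sets only, where sup is the true supremum. *)
Definition ediam (A : set 'rV[R]_m) : R :=
  sup [set enorm (x - y) | x in A & y in A].

Definition eball_in (A : set 'rV[R]_m) (x0 : 'rV[R]_m) (delta : R) :
  set 'rV[R]_m := [set x | A x /\ enorm (x - x0) <= delta].

End euclidean.

Section entropy.
Local Open Scope ereal_scope.
Context {d : measure_display} {T : measurableType d} {R : realType}.

Definition positive_envelope (F : set (T -> R)) (C : T -> R) : Prop :=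
  [/\ forall h, F h -> measurable_fun setT h,
      measurable_fun setT C,
      forall z, (0 < C z)%R
    & forall h, F h -> forall z, (`|h z| <= C z)%R].

(* The infimum of the empty set being +oo, this is +oo without a finite cover. *)
Definition covering_number (Q : probability T R) (eta : \bar R)
    (F : set (T -> R)) : \bar R :=
  ereal_inf [set n%:R%:E | n in [set n : nat |
    exists c : 'I_n -> (T -> R), (forall i, F (c i)) /\
      (forall h, F h -> exists i,
        'N[Q]_2%:E[EFin \o (fun z => h z - c i z)%R] <= eta)]].

Definition finitely_supported (Q : probability T R) : Prop :=
  exists A : set T, [/\ finite_set A, measurable A & Q A = 1].

(* The exponent 1/2 is the square root on [0, +oo], with value +oo at +oo. *)
Definition entropy_integral (F : set (T -> R)) (C : T -> R) (delta : R) :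
    \bar R :=
  \int[lebesgue_measure]_(e in `]0%R, delta])
    ereal_sup [set
      (lne (2%:E *
         covering_number Q (e%:E * 'N[Q]_2%:E[EFin \o C]) F)) `^ (2^-1)%R
      | Q in [set Q : probability T R | finitely_supported Q]].

End entropy.

Section power_probability.
Context {d : measure_display} {T : measurableType d} {R : realType}.

Definition tuple_cons (n : nat) (x : T * n.-tuple T) : n.+1.-tuple T :=
  [tuple of x.1 :: x.2].

Lemma measurable_tuple_cons n : measurable_fun setT (@tuple_cons n).
Proof. exact: measurable_cons. Qed.

HB.instance Definition _ n :=
  isMeasurableFun.Build _ _ _ _ (@tuple_cons n) (@measurable_tuple_cons n).

Fixpoint power_probability (P : probability T R) (n : nat) :
    probability (n.-tuple T) R :=
  match n with
  | 0%N => dirac [tuple]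
  | k.+1 => distribution (P \x power_probability P k)%E (@tuple_cons k)
  end.

Lemma power_probability_box (P : probability T R) n (A : 'I_n -> set T) :
  (forall i, measurable (A i)) ->
  power_probability P n [set t | forall i, A i (tnth t i)] =
  (\prod_(i < n) P (A i))%E.
Proof.
elim: n A => [|n IHn] A mA.
  rewrite big_ord0 /= /dirac indicE mem_set//.
  by move=> [].
pose B := [set t : n.-tuple T | forall i, A (lift ord0 i) (tnth t i)].
have mB : measurable B.
  rewrite (_ : B = \bigcap_(i in [set: 'I_n])
      ((fun t : n.-tuple T => tnth t i) @^-1` A (lift ord0 i))).
    apply: fin_bigcap_measurable => // i _.
    rewrite -[X in measurable X]setTI.
    exact: measurable_tnth.
  by apply/seteqP; split=> t /= Bt i; [move=> _; exact: Bt|exact: (Bt i I)].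
rewrite big_ord_recl -(IHn (fun i => A (lift ord0 i)))// -product_measure1E//.
rewrite /= /distribution /pushforward; congr (product_measure1 _ _ _).
apply/seteqP; split=> -[x t] /=.
  move=> At; split=> [|i]; first exact: (At ord0).
  by have := At (lift ord0 i); rewrite tnthS.
move=> [Ax Bt] i; case: (unliftP ord0 i) => [j ->|->] //.
by rewrite tnthS; exact: Bt.
Qed.

End power_probability.

(* Main.v *)
(** Hölder continuity turns an [s ^ (1 / beta) * D]-net of the parameter set, of
    diameter or radius [D], into an [s * E]-net of the function class with
    envelope [E >= C * D ^ beta]. A maximal separated family is such a net, and
    lattice point counting bounds its size by [(8 * s ^ (- 1 / beta)) ^ m], so the
    integrand of the entropy integral is at most [sqrt (a + b * ln (1 / s))] with
    [a = (3 * m + 1) * ln 2] and [b = m / beta]. Let [y = a + b * ln (2 / eps)].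
    Then [b <= y], hence [a + b * ln (1 / s) <= y * (1 + n)] as soon as
    [eps / s <= 2 ^ n]. The integrand is therefore at most [sqrt y * (1 + n / 2)],
    a sum of indicators of the dyadic intervals [(0, eps / 2 ^ j]] with integral
    [2 * eps * sqrt y]. *)
Require Import Defs.
From mathcomp Require Import all_boot all_order all_algebra.
From mathcomp Require Import all_classical all_reals all_analysis.
From mathcomp Require Import measurable_realfun.
From mathcomp Require Import lra ring zify.

Import Order.TTheory GRing.Theory Num.Theory.
Import numFieldNormedType.Exports.

Local Open Scope classical_set_scope.
Local Open Scope ring_scope.

(** * Elementary properties of the Euclidean norm *)

Section enorm_theory.
Context {R : realType} {m : nat}.
Implicit Types x y : 'rV[R]_m.

Lemma sqr_enorm x : enorm x ^+ 2 = \sum_(i < m) x ord0 i ^+ 2.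
Proof. by rewrite sqr_sqrtr// sumr_ge0// => i _; exact: sqr_ge0. Qed.

Lemma enorm_ge0 x : 0 <= enorm x.
Proof. exact: sqrtr_ge0. Qed.

Lemma enormZ (a : R) x : enorm (a *: x) = `|a| * enorm x.
Proof.
rewrite /enorm; under eq_bigr do rewrite mxE exprMn.
by rewrite -mulr_sumr sqrtrM ?sqr_ge0// sqrtr_sqr.
Qed.

Lemma enormN x : enorm (- x) = enorm x.
Proof. by rewrite -scaleN1r enormZ normrN1 mul1r. Qed.

Lemma enormB x y : enorm (x - y) = enorm (y - x).
Proof. by rewrite -enormN opprB. Qed.

Lemma ler_coord_enorm x i : `|x ord0 i| <= enorm x.
Proof.
rewrite -sqrtr_sqr ler_sqrt; last first.
  by apply: sumr_ge0 => j _; exact: sqr_ge0.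
by rewrite (bigD1 i)//= lerDl sumr_ge0// => j _; exact: sqr_ge0.
Qed.

(** The factor [m] in place of its square root is crude, but the scale [8 * m.+1] of the separation
    argument absorbs it. *)
Lemma enorm_le_coord x (b : R) : 0 <= b ->
  (forall i, `|x ord0 i| <= b) -> enorm x <= m%:R * b.
Proof.
move=> b0 xb; have mb0 : 0 <= m%:R * b by rewrite mulr_ge0.
rewrite -(ger0_norm mb0) -sqrtr_sqr ler_sqrt ?sqr_ge0//.
apply: (@le_trans _ _ (\sum_(i < m) b ^+ 2)).
  apply: ler_sum => i _; rewrite -[x ord0 i ^+ 2]real_normK ?num_real//.
  by rewrite lerXn2r ?nnegrE// xb.
rewrite sumr_const card_ord -(mulr_natl (b ^+ 2)) exprMn ler_wpM2r ?sqr_ge0//.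
by rewrite -natrX ler_nat; case: (m) => // k; rewrite expnS expn1 leq_pmulr.
Qed.

Lemma enorm_dot_le x y :
  \sum_(i < m) x ord0 i * y ord0 i <= enorm x * enorm y.
Proof.
have coord0 (z : 'rV[R]_m) i : enorm z = 0 -> z ord0 i = 0.
  by move=> z0; apply/eqP; rewrite -normr_le0; have := ler_coord_enorm z i; rewrite z0.
have [x0|x0] := eqVneq (enorm x) 0.
  by rewrite x0 mul0r big1// => i _; rewrite coord0// mul0r.
have [y0|y0] := eqVneq (enorm y) 0.
  by rewrite y0 mulr0 big1// => i _; rewrite [y _ _]coord0// mulr0.
have xy0 : 0 < enorm x * enorm y by rewrite mulr_gt0// lt0r enorm_ge0 andbT.
have : 0 <= \sum_(i < m) (enorm y * x ord0 i - enorm x * y ord0 i) ^+ 2.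
  by apply: sumr_ge0 => i _; exact: sqr_ge0.
rewrite (_ : \sum_(i < m) _ = 2 * (enorm x * enorm y) *
    (enorm x * enorm y - \sum_(i < m) x ord0 i * y ord0 i)).
  by rewrite pmulr_rge0 ?subr_ge0// mulr_gt0.
transitivity (enorm y ^+ 2 * (\sum_(i < m) x ord0 i ^+ 2) +
    enorm x ^+ 2 * (\sum_(i < m) y ord0 i ^+ 2) -
    2 * (enorm x * enorm y) * \sum_(i < m) x ord0 i * y ord0 i).
  rewrite !mulr_sumr -big_split/= -sumrB; apply: eq_bigr => i _; ring.
rewrite -!sqr_enorm; ring.
Qed.

Lemma ler_enormD x y : enorm (x + y) <= enorm x + enorm y.
Proof.
have xy0 : 0 <= enorm x + enorm y by rewrite addr_ge0 ?enorm_ge0.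
rewrite -(ger0_norm xy0) -sqrtr_sqr ler_sqrt ?sqr_ge0//.
under eq_bigr do rewrite mxE sqrrD.
rewrite big_split/= big_split/= -!sqr_enorm sqrrD lerD2r lerD2l sumrMnl lerMn2r/=.
exact: enorm_dot_le.
Qed.

Lemma ler_enormB x y : enorm (x - y) <= enorm x + enorm y.
Proof. by rewrite -[enorm y]enormN ler_enormD. Qed.

End enorm_theory.

(** * Separated families and finite nets by lattice point counting *)

(* Let L be the set of lattice points of norm at most 3(m+1). Dividing the
   lattice point floor(X i) + l by k yields a remainder in [0, k)^m and a
   quotient in L, and the pair (i, l) is recovered from both because the X i
   are far apart. Hence N * #|L| <= k ^ m * #|L|. *)
Lemma card_separated_le (R : realType) (m N k : nat) (K : R)
    (X : 'I_N -> 'rV[R]_m) :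
  0 <= K -> 4 * K + 2 <= k%:R ->
  (forall i, enorm (X i) <= 8 * m.+1%:R * K) ->
  (forall i j, i != j -> 8 * m.+1%:R < enorm (X i - X j)) ->
  (N <= k ^ m)%N.
Proof.
move=> K0 kK XK Xsep.
have k0R : 0 < k%:R :> R by lra.
case: k kK k0R => [|k] kK k0R; first by rewrite ltxx in k0R.
(* Taking [m.+1] rather than [m] keeps the scale positive in dimension 0. *)
pose M : R := m.+1%:R.
have M0 : 0 < M by rewrite ltr0n.
have mM : m%:R <= M by rewrite ler_nat.
(* An index in [[0, 6 (m + 1)]], shifted by [3 (m + 1)], runs through all integers that can be a
   coordinate of a vector of norm at most [3 M]. *)
pose B := (6 * m.+1)%N.
pose Z (f : {ffun 'I_m -> 'I_B.+1}) : 'rV[R]_m :=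
  \row_j ((f j)%:R - 3 * M).
pose L := [set f | enorm (Z f) <= 3 * M]%SET.
pose p i (f : {ffun 'I_m -> 'I_B.+1}) j : int :=
  Num.floor (X i ord0 j) + (f j)%:Z - (3 * m.+1)%N%:Z.
pose rem i f : {ffun 'I_m -> 'I_k.+1} :=
  [ffun j => inord (absz (p i f j %% k.+1%:Z)%Z)].
pose quo i f : {ffun 'I_m -> 'I_B.+1} :=
  [ffun j => inord (absz ((p i f j %/ k.+1%:Z)%Z + (3 * m.+1)%N%:Z))].
pose Phi u := (rem u.1 u.2, quo u.1 u.2).
pose F i : 'rV[R]_m := \row_j (X i ord0 j - (Num.floor (X i ord0 j))%:~R).
have F_itv i j : 0 <= F i ord0 j < 1.
  rewrite mxE subr_ge0 floor_le_tmp ltrBlDl.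
  by have := floorD1_gt (X i ord0 j); rewrite intrD.
have pE i f : \row_j (p i f j)%:~R = X i - F i + Z f.
  apply/rowP => j; rewrite !mxE /p intrB intrD -!pmulrn natrM /M; ring.
pose Q i f : 'rV[R]_m := \row_j ((p i f j %/ k.+1%:Z)%Z)%:~R.
have modE i f j : (0 <= (p i f j %% k.+1%:Z)%Z < k.+1%:Z).
  by rewrite modz_ge0//= ltz_pmod.
(* In [k Q = X - F + Z - c] the terms on the right have norms at most [8 M K], [M], [3 M] and [M k].
   Their sum is [2 M (4 K + 2) + M k], at most [3 M k], so that the quotient stays in the same ball
   as [Z f]. *)
have Q_le i f : f \in L -> enorm (Q i f) <= 3 * M.
  rewrite inE => fL.
  pose c : 'rV[R]_m := \row_j ((p i f j %% k.+1%:Z)%Z)%:~R.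
  have QE : k.+1%:R *: Q i f = X i - F i + Z f - c.
    rewrite -pE; apply/rowP => j; rewrite !mxE.
    rewrite {2}(divz_eq (p i f j) k.+1%:Z) rmorphD rmorphM/= -pmulrn; ring.
  have F_le : enorm (F i) <= M.
    apply: le_trans mM; rewrite -[leRHS]mulr1; apply: enorm_le_coord => // j.
    by have /andP[? ?] := F_itv i j; rewrite ger0_norm// ltW.
  have c_le : enorm c <= M * k.+1%:R.
    apply: (@le_trans _ _ (m%:R * k.+1%:R)); last by rewrite ler_wpM2r.
    apply: enorm_le_coord => // j; rewrite mxE.
    have /andP[p0 pk] := modE i f j.
    by rewrite ger0_norm ?ler0z// pmulrn ler_int ltW.
  have := ler_enormB (X i - F i + Z f) c; rewrite -QE enormZ ger0_norm//.
  have := ler_enormD (X i - F i) (Z f); have := ler_enormB (X i) (F i).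
  have := XK i; rewrite -/M -(ler_pM2l k0R) => h1 h2 h3 h4.
  have : M * (4 * K + 2) <= M * k.+1%:R by rewrite ler_pM2l.
  nra.
(* By [Q_le] the shifted quotient lies in [[0, B]], so [inord] does not fall back to its default
   value. *)
have quo_val i f j : f \in L ->
    ((quo i f j)%:Z = (p i f j %/ k.+1%:Z)%Z + (3 * m.+1)%N%:Z)%R.
  move=> /(Q_le i) Qle; have := le_trans (ler_coord_enorm _ j) Qle.
  rewrite mxE ler_norml (_ : 3 * M = (3 * m.+1)%N%:Z%:~R); last first.
    by rewrite -pmulrn natrM.
  rewrite -rmorphN !ler_int => /andP[q1 q2].
  by rewrite ffunE inordK; lia.
have rem_val i f j : (rem i f j)%:Z = (p i f j %% k.+1%:Z)%Z.
  by have := modE i f j; rewrite ffunE => /andP[? ?]; rewrite inordK; lia.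
have quo_L i f : f \in L -> quo i f \in L.
  move=> fL; rewrite inE (_ : Z _ = Q i f) ?Q_le//.
  apply/rowP => j; rewrite !mxE pmulrn quo_val// rmorphD/= -pmulrn.
  by rewrite natrM addrK.
have Phi_inj : {in finset.setX [set: 'I_N]%SET L &, injective Phi}.
  move=> [i f] [i' f'] /finset.setXP[_ fL] /finset.setXP[_ f'L] [remE quoE].
  have pp j : p i f j = p i' f' j.
    rewrite (divz_eq (p i f j) k.+1%:Z) (divz_eq (p i' f' j) k.+1%:Z).
    rewrite -!rem_val remE; congr (_ * _ + _).
    by apply: (addIr (3 * m.+1)%N%:Z); rewrite -!quo_val// quoE.
  (* Equal lattice points force [X i - X i' = Z f' - Z f + (F i - F i')], of norm at most
     [3 M + 3 M + M = 7 M], short of the separation [8 M]. *)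
  have ii : i = i'.
    apply/eqP/negPn/negP => /Xsep; apply/negP; rewrite -leNgt -/M.
    have XE : X i - X i' = Z f' - Z f + (F i - F i').
      have : X i - F i + Z f = X i' - F i' + Z f'.
        by rewrite -!pE; apply/rowP => j; rewrite !mxE pp.
      move=> /(congr1 (fun u => u + F i - Z f - X i')).
      rewrite (_ : _ - X i' = X i - X i'); last first.
        by apply/rowP => j; rewrite !mxE; ring.
      by move=> ->; apply/rowP => j; rewrite !mxE; ring.
    have FF : enorm (F i - F i') <= M.
      apply: le_trans mM; rewrite -[leRHS]mulr1; apply: enorm_le_coord => // j.
      have := F_itv i j; have := F_itv i' j.
      rewrite (_ : (F i - F i') _ _ = F i ord0 j - F i' ord0 j) ?mxE//.
      by rewrite ler_norml; lra.
    have := ler_enormD (Z f' - Z f) (F i - F i'); rewrite -XE.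
    have := ler_enormB (Z f') (Z f).
    by move: fL f'L; rewrite !inE; lra.
  (* For a common [i] the floors cancel in [pp], which leaves [f j = f' j]. *)
  rewrite -ii in pp *; congr pair; apply/ffunP => j; apply/val_inj/eqP.
  by have := pp j; rewrite /p => /addIr/addrI/eqP.
(* The zero vector belongs to [L], hence [#|L|] can be cancelled from the count. *)
have L0 : (0 < #|L|)%N.
  apply/card_gt0P; exists [ffun=> inord (3 * m.+1)]; rewrite inE.
  rewrite (_ : Z _ = 0 *: 0) ?enormZ ?normr0 ?mul0r; first by lra.
  apply/rowP => j; rewrite !mxE ffunE inordK ?natrM ?subrr ?mul0r//.
  by rewrite ltnS leq_mul2r orbT.
rewrite -(leq_pmul2r L0) -[X in (X ^ _)%N](card_ord k.+1) -[X in (_ ^ X)%N](card_ord m).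
rewrite -card_ffun -[leqLHS](_ : #|finset.setX [set: 'I_N]%SET L| = _); last first.
  by rewrite cardsX cardsT card_ord.
rewrite -(card_in_imset Phi_inj) -cardsT -cardsX.
apply: subset_leq_card; apply/fintype.subsetP => _ /imsetP[[i f] /finset.setXP[_ fL] ->].
by rewrite inE/= finset.in_setT quo_L.
Qed.

(** Separated families in [A] have bounded size, so one of maximal size exists. A point farther than
    [r] from all its members could be added to it. *)
Lemma finite_enorm_net (R : realType) (m k : nat) (A : set 'rV[R]_m)
    (x0 : 'rV[R]_m) (D r : R) :
  0 < r -> 0 <= D -> 4 * (D / r) + 2 <= k%:R ->
  (forall x, A x -> enorm (x - x0) <= D) ->
  exists (N : nat) (c : 'I_N -> 'rV[R]_m), [/\ (N <= k ^ m)%N,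
    forall i, A (c i) & forall x, A x -> exists i, enorm (x - c i) <= r].
Proof.
move=> r0 D0 kD AD.
pose sep N := `[< exists c : 'I_N -> 'rV[R]_m,
  (forall i, A (c i)) /\ forall i j, i != j -> r < enorm (c i - c j) >].
have sep0 : exists N, sep N.
  by exists 0%N; apply/asboolP; exists (fun=> 0); split=> -[].
have sep_le N : sep N -> (N <= k ^ m)%N.
  move=> /asboolP[c [Ac cr]].
  (* Rescaling by [t] turns separation [r] into [8 (m + 1)] and radius [D] into [8 (m + 1) K] with
     [K = D / r]. *)
  pose t := 8 * m.+1%:R / r.
  have t0 : 0 < t by rewrite divr_gt0// mulr_gt0.
  apply: (@card_separated_le R m N k (D / r) (fun i => t *: (c i - x0))).
  - by rewrite divr_ge0// ltW.
  - exact: kD.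
  - move=> i; rewrite enormZ gtr0_norm//.
    rewrite (_ : 8 * m.+1%:R * (D / r) = t * D) ?ler_pM2l ?AD// /t; ring.
  - move=> i j ij; rewrite -scalerBr opprB addrA subrK enormZ gtr0_norm//.
    by rewrite -[ltLHS](@divfK _ r) ?gt_eqF// ltr_pM2l// cr.
case: (ex_maxnP sep0 sep_le) => N /[dup] sepN /asboolP[c [Ac cr]] Nmax.
exists N, c; split=> // [|x Ax]; first exact: sep_le.
apply: contrapT => xc; suff /Nmax : sep N.+1 by rewrite ltnn.
have xc' i : r < enorm (x - c i).
  by rewrite ltNge; apply/negP => xci; apply: xc; exists i.
apply/asboolP; exists (fun i => oapp c x (unlift ord0 i)); split=> [i|i j].
  by case: unliftP => [j|] _ /=.
case: unliftP => [i' ->|->]; case: unliftP => [j' ->|->] //=.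
  by rewrite (inj_eq lift_inj); exact: cr.
by rewrite enormB.
Qed.

(** * Covering numbers of Hölder classes *)

Local Lemma in_itv0y (R : realType) (x : \bar R) :
  (0 <= x)%E -> x \in `[0%E, +oo%E].
Proof. by move=> x0; rewrite in_itv/= leey x0. Qed.

Section covering.
Context {R : realType} {m : nat} {d : measure_display} {T : measurableType d}.
Variables (A : set 'rV[R]_m) (x0 : 'rV[R]_m) (D beta : R).
Variables (F : 'rV[R]_m -> T -> R) (C E : T -> R).
Hypotheses (D0 : 0 < D) (AD : forall x, A x -> enorm (x - x0) <= D).
Hypothesis beta0 : 0 < beta.
Hypotheses (mF : forall x, A x -> measurable_fun setT (F x)).
Hypotheses (mE : measurable_fun setT E).
Hypothesis C0 : forall z, 0 <= C z.
Hypothesis F_holder : forall z x y, A x -> A y ->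
  `|F x z - F y z| <= C z * enorm (x - y) `^ beta.
Hypothesis CE : forall z, C z * D `^ beta <= E z.

Local Lemma Lnorm_scale_le (Q : probability T R) (s : R) (h : T -> R) :
  0 <= s -> measurable_fun setT h -> (forall z, `|h z| <= s * E z) ->
  ('N[Q]_2%:E[EFin \o h] <= s%:E * 'N[Q]_2%:E[EFin \o E])%E.
Proof.
move=> s0 mh hE; rewrite unlock.
have mpow (g : T -> R) : measurable_fun setT g ->
    measurable_fun setT (fun z => `|(EFin \o g) z| `^ 2)%E.
  move=> mg; apply: (@measurableT_comp _ _ _ _ _ _ (fun x => x `^ 2)%E).
    exact: (measurable_poweR 2).
  apply: measurableT_comp => //; exact/measurable_EFinP.
have int_ge0 (g : T -> R) : (0 <= \int[Q]_z (`|(EFin \o g) z| `^ 2))%E.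
  by apply: integral_ge0 => z _; exact: poweR_ge0.
(* Written as a square root, the factor can be moved under the outer exponent and into the
   integral. *)
have -> : s%:E = ((s%:E `^ 2) `^ 2^-1)%E.
  by rewrite -poweRrM mulfV// poweRe1.
rewrite -poweRM ?poweR_ge0//.
apply: gt0_ler_poweR => //.
- exact/in_itv0y/int_ge0.
- by apply/in_itv0y/mule_ge0; [exact: poweR_ge0|exact: int_ge0].
rewrite -ge0_integralZl//; last 3 first.
- exact: mpow.
- by move=> z _; exact: poweR_ge0.
- exact: poweR_ge0.
apply: ge0_le_integral => //.
- by move=> z _; exact: poweR_ge0.
- exact: mpow.
- by apply: measurable_funeM; exact: mpow.
move=> z _; rewrite -poweRM//= lee_fin; apply: ge0_ler_powR => //.
  by rewrite nnegrE mulr_ge0.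
by rewrite (le_trans (hE z))// ler_wpM2l// ler_norm.
Qed.

Lemma covering_number_holder_le (Q : probability T R) (s : R) :
  0 < s -> s <= 1 ->
  (covering_number Q (s%:E * 'N[Q]_2%:E[EFin \o E]) [set F x | x in A] <=
   ((8 * s `^ (- beta^-1)) ^+ m)%:E)%E.
Proof.
move=> s0 s1; set K := s `^ (- beta^-1).
have ibeta0 : 0 <= beta^-1 by rewrite invr_ge0 ltW.
have KV : s `^ beta^-1 = K^-1 by rewrite /K powRN invrK.
have K0 : 0 < K by exact: powR_gt0.
have K1 : 1 <= K.
  rewrite -invr_le1 ?unitfE ?gt_eqF// -KV.
  rewrite [leRHS](_ : 1 = 1 `^ beta^-1); last by rewrite powR1.
  by apply: ge0_ler_powR => //; rewrite nnegrE// ltW.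
(* This radius satisfies [r ^ beta = s * D ^ beta], so functions with parameters at distance at most
   [r] differ by at most [C * s * D ^ beta <= s * E]. *)
pose r := D / K; have r0 : 0 < r by rewrite divr_gt0.
have rs : r `^ beta = s * D `^ beta.
  rewrite /r mulrC -KV powRM ?powR_ge0 ?ltW// -powRrM mulVf ?gt_eqF//.
  by rewrite powRr1// ltW.
have K40 : 0 <= 4 * K by rewrite mulr_ge0// ltW.
have /andP[] := truncn_itv K40; set n := Num.truncn _ => nK Kn.
(* From [n <= 4 K < n + 1] follows [4 K + 2 < k <= 4 K + 3], and [K >= 1] bounds the latter by
   [8 K]. *)
pose k := n.+3.
have /andP[Kk kK] : 4 * K + 2 <= k%:R <= 8 * K.
  have kE : k%:R = n%:R + 3 :> R by rewrite /k -[in LHS]addn3 (natrD _ n 3).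
  have nE : n.+1%:R = n%:R + 1 :> R by rewrite -natr1.
  by rewrite kE; rewrite nE in Kn; apply/andP; split; lra.
have Dr : D / r = K by rewrite /r invf_div mulrCA divff ?gt_eqF// mulr1.
have [|N [c [Nk Ac Acov]]] := @finite_enorm_net R m k A x0 D r r0 (ltW D0) _ AD.
  by rewrite Dr.
apply: (@le_trans _ _ (N%:R%:E)); last first.
  rewrite lee_fin (le_trans (_ : _ <= (k ^ m)%:R)) ?ler_nat// natrX.
  by rewrite lerXn2r ?nnegrE// mulr_ge0// ltW.
apply: ereal_inf_lbound => /=; exists N => //.
exists (F \o c); split=> [i|_ [x Ax <-]]; first by exists (c i).
have [i xci] := Acov x Ax; exists i; apply: Lnorm_scale_le; first exact: ltW.
  by apply: measurable_funB; apply: mF.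
move=> z; apply: (le_trans (F_holder z x (c i) Ax (Ac i))).
apply: (@le_trans _ _ (C z * r `^ beta)).
  rewrite ler_wpM2l//; apply: ge0_ler_powR => //; first exact: ltW.
  - by rewrite nnegrE enorm_ge0.
  - by rewrite nnegrE ltW.
by rewrite rs mulrCA ler_wpM2l ?(ltW s0).
Qed.

(** A cover of a nonempty class needs a center. This keeps [ln (2 N)] nonnegative, where the square
    root is monotone. *)
Lemma covering_number_ge1 (Q : probability T R) (eta : \bar R)
    (H : set (T -> R)) :
  H !=set0 -> (1 <= covering_number Q eta H)%E.
Proof.
move=> [h Hh]; apply: le_ereal_inf_tmp => _ [n [c [_ cH]] <-].
by have [i _] := cH h Hh; rewrite lee_fin ler1n (leq_ltn_trans _ (ltn_ord i)).
Qed.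

Lemma sqrt_lne_covering_le (Q : probability T R) (s : R) :
  A !=set0 -> 0 < s -> s <= 1 ->
  (lne (2%:E *
     covering_number Q (s%:E * 'N[Q]_2%:E[EFin \o E]) [set F x | x in A])
     `^ 2^-1 <=
   (Num.sqrt ((3 * m + 1)%:R * ln 2 + m%:R / beta * ln s^-1))%:E)%E.
Proof.
move=> [x Ax] s0 s1; set cov := covering_number _ _ _.
have cov1 : (1 <= cov)%E by apply: covering_number_ge1; exists (F x), x.
have cov0 : (0 <= cov)%E by apply: le_trans cov1.
have K0 : 0 < 8 * s `^ (- beta^-1) by rewrite mulr_gt0// powR_gt0.
set y := (X in Num.sqrt X).
(* Since [8 = 2 ^ 3], the logarithm is [ln 2 + m (3 ln 2 + ln (1 / s) / beta)], the source of the
   constant [3 m + 1]. *)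
have yE : y = ln (2 * (8 * s `^ (- beta^-1)) ^+ m).
  rewrite lnM ?posrE ?exprn_gt0// lnXn// lnM ?posrE ?powR_gt0//.
  rewrite ln_powR (_ : 8 = 2 ^+ 3); last by ring.
  rewrite lnXn// /y lnV ?posrE//.
  have -> : (3 * m + 1)%:R = 3 * m%:R + 1 :> R by rewrite natrD natrM.
  rewrite -(mulr_natr (ln 2)) -(mulr_natr (_ + _) m).
  by move: (ln 2) (ln s) beta^-1 => L l b; ring.
have lne_le : (lne (2%:E * cov) <= y%:E)%E.
  rewrite yE -lne_EFin ?mulr_gt0 ?exprn_gt0// lee_lne.
  - by rewrite EFinM lee_wpmul2l// covering_number_holder_le.
  - exact/in_itv0y/mule_ge0.
  - by apply/in_itv0y; rewrite lee_fin mulr_ge0// exprn_ge0// ltW.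
have lne0 : (0 <= lne (2%:E * cov))%E.
  rewrite lne_ge0 (le_trans cov1)// -[leLHS]mul1e lee_wpmul2r//.
  by rewrite lee_fin ler1n.
have y0 : 0 <= y by rewrite -lee_fin (le_trans lne0).
rewrite -powR12_sqrt// -poweR_EFin; apply: gt0_ler_poweR => //.
- exact/in_itv0y.
- exact/in_itv0y.
Qed.

End covering.

(** * The dyadic bound on the entropy integral *)

(** The entropy integrand is a supremum over an uncountable family of measures, so its measurability
    is left open. Comparison still works: the negative part only lowers the integral, and the
    integral of the positive part is a supremum over simple functions below it, each of which is
    also below [g]. *)
Lemma le_integral_nonmeasurable (d : measure_display) (T : measurableType d)
    (R : realType) (mu : {measure set T -> \bar R}) (A : set T)
    (f g : T -> \bar R) :
  (forall x, A x -> 0 <= g x)%E -> (forall x, A x -> f x <= g x)%E ->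
  (\int[mu]_(x in A) f x <= \int[mu]_(x in A) g x)%E.
Proof.
move=> g0 fg; rewrite integralE.
apply: (@le_trans _ _ (\int[mu]_(x in A) f^\+ x)%E).
  by rewrite -[leRHS]sube0 leeB ?integral_ge0.
rewrite !ge0_integralE//; apply: ge_ereal_sup => _ [h hf <-].
apply: ereal_sup_ubound; exists h => // x.
apply: (le_trans (hf x)); rewrite /patch; case: ifPn => //; rewrite inE => Ax.
by rewrite funeposE ge_max fg// g0.
Qed.

(* The step function majorizes [ln (eps / s)] because
   [ln (eps / s) <= n] whenever [2 ^ (n - 1) <= eps / s <= 2 ^ n]. *)
Lemma sqrt_ln_le_dyadic (R : realType) (a b eps s : R) (y := a + b * ln (2 / eps)) :
  0 <= b -> 0 < eps -> 0 < s -> s <= eps -> b <= y ->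
  ((Num.sqrt (a + b * ln s^-1))%:E <=
   (Num.sqrt y)%:E + (Num.sqrt y / 2)%:E *
     \sum_(j <oo) (\1_(`]0%R, (eps / 2 ^+ j)%R]) s)%:E)%E.
Proof.
move=> b0 eps0 s0 seps b_le.
have y0 : 0 <= y by exact: le_trans b_le.
have exn : exists n, eps / s <= 2 ^+ n.
  exists (Num.truncn (eps / s)).+1; apply/ltW/(lt_le_trans (truncnS_gt _)).
  by rewrite -natrX ler_nat ltnW// ltn_expl.
case: (ex_minnP exn) => n epsn nmin.
(* The left side equals [y - b ln 2 + b ln (eps / s)]; [ln 2 <= 1] gives [ln (eps / s) <= n], and
   [b <= y] does the rest. *)
have ln_le : a + b * ln s^-1 <= y * (1 + n%:R).
  have ln2_ge0 : 0 <= ln (2 : R) by rewrite ln_ge0// ler1n.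
  have ln2_le1 : ln (2 : R) <= 1 by have := @le_ln1Dx R 1; apply; lra.
  have : ln (eps / s) <= n%:R.
    apply: (@le_trans _ _ (ln (2 ^+ n))).
      by rewrite ler_ln ?posrE ?divr_gt0// exprn_gt0.
    by rewrite lnXn// -(mulr_natl (ln 2)) ler_piMr.
  rewrite ln_div ?posrE// => ln_le_n.
  have : b * (ln eps - ln s) <= b * n%:R by rewrite ler_wpM2l.
  have : b * n%:R <= y * n%:R by rewrite ler_wpM2r.
  have : 0 <= b * ln 2 by rewrite mulr_ge0.
  rewrite /y ln_div ?posrE// lnV ?posrE//.
  move: (ln 2) (ln eps) (ln s) (n%:R : R) => l2 le ls r; lra.
apply: (@le_trans _ _ ((Num.sqrt y)%:E + (Num.sqrt y / 2)%:E * n%:R%:E)%E).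
  rewrite -EFinM -EFinD lee_fin.
  apply: (@le_trans _ _ (Num.sqrt (y * (1 + n%:R)))).
    by rewrite ler_sqrt// mulr_ge0.
  (* What remains is [sqrt (1 + n) <= 1 + n / 2], checked by squaring. *)
  rewrite sqrtrM// -[X in _ <= X + _]mulr1 -mulrA -mulrDr ler_wpM2l ?sqrtr_ge0//.
  have n0 : 0 <= 1 + 2^-1 * n%:R :> R by rewrite addr_ge0// mulr_ge0.
  rewrite -[leRHS]ger0_norm// -sqrtr_sqr ler_sqrt ?sqr_ge0//.
  have : 0 <= n%:R :> R by [].
  nra.
rewrite leeD2l// lee_wpmul2l ?lee_fin ?divr_ge0 ?sqrtr_ge0//.
(* By minimality of [n], each [j < n] has [2 ^ j < eps / s], so [s] lies in the first [n] intervals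
   and their indicators add up to [n]. *)
apply: (@le_trans _ _ (\sum_(0 <= j < n) (\1_(`]0%R, (eps / 2 ^+ j)%R]) s)%:E)%E).
  rewrite sumEFin lee_fin (eq_big_nat _ _ (F2 := fun=> 1)) ?sumr_const_nat ?subn0//.
  move=> j /andP[_ jn]; rewrite indicE mem_set//= in_itv/= s0/=.
  rewrite ler_pdivlMr ?exprn_gt0// mulrC -ler_pdivlMr// ltW// ltNge.
  by apply/negP => /nmin; rewrite leqNgt jn.
by apply: nneseries_lim_ge => j _ _; rewrite lee_fin.
Qed.

(** The interval lengths [eps / 2 ^ j] sum to [2 * eps], so the constant and the series contribute
    [c * eps] each. *)
Lemma integral_dyadic_le (R : realType) (c eps : R) : 0 <= c -> 0 < eps ->
  (\int[lebesgue_measure]_(s in `]0%R, eps]) (c%:E + (c / 2)%:E *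
     \sum_(j <oo) (\1_(`]0%R, (eps / 2 ^+ j)%R]) s)%:E) <=
   (2 * eps * c)%:E)%E.
Proof.
move=> c0 eps0.
pose T j := `]0%R, (eps / 2 ^+ j)%R]%classic.
have mT j : measurable (T j) by exact: measurable_itv.
pose I j (s : R) : \bar R := (\1_(T j) s)%:E.
have I0 j s : (0 <= I j s)%E by rewrite lee_fin.
have mI j : measurable_fun `]0%R, eps]%classic (I j).
  by apply/measurable_EFinP; exact: measurable_indic.
have mS : measurable_fun `]0%R, eps]%classic (fun s => \sum_(j <oo) I j s)%E.
  have I0' j s : `]0%R, eps]%classic s -> xpredT j -> (0 <= I j s)%E by [].
  exact: (ge0_emeasurable_sum I0' (fun j _ => mI j)).
have S0 s : (0 <= \sum_(j <oo) I j s)%E by exact: nneseries_ge0.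
rewrite ge0_integralD//; last 2 first.
- by move=> s _; rewrite mule_ge0// ?S0// lee_fin divr_ge0.
- exact: measurable_funeM.
rewrite integral_cst// ge0_integralZl//; last 2 first.
- by move=> s _; exact: S0.
- by rewrite lee_fin divr_ge0.
have mu_itv (e : R) : 0 < e -> lebesgue_measure (`]0%R, e]%classic : set R) = e%:E.
  by move=> e0; rewrite lebesgue_measure_itv/= lte_fin e0 oppr0 adde0.
rewrite [X in (_ * X + _)%E](mu_itv _ eps0) integral_nneseries//.
rewrite (_ : 2 * eps * c = c * eps + c / 2 * (2 * eps)); last by field.
rewrite EFinD (EFinM c eps) leeD2l// (EFinM (c / 2) (2 * eps)).
rewrite lee_wpmul2l ?lee_fin ?divr_ge0//.
(* The series there has terms [e / 2 ^ (j + 1)]; the choice [e = 2 * eps] compensates for the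
   shift. *)
apply: le_trans (epsilon_trick0 xpredT _); last by rewrite mulr_ge0// ltW.
apply: lee_nneseries => j _.
  by move=> _; exact: integral_ge0.
rewrite integral_indic//.
apply: (@le_trans _ _ (lebesgue_measure (T j))).
  apply: le_measure; rewrite ?inE//; last exact: mT.
  exact: (measurableI _ _ (mT j) (measurable_itv _)).
rewrite [leLHS]mu_itv ?divr_gt0 ?exprn_gt0// lee_fin natrX exprS invfM mulrACA.
by rewrite divff ?mul1r.
Qed.

(** The center [x0] and radius [D] are left free to serve both claims: [D] is the diameter for the
    full class and [2 * delta] for the local one. *)
Lemma entropy_integral_holder_le (R : realType) (m : nat)
    (d : measure_display) (T : measurableType d) (A : set 'rV[R]_m)
    (x0 : 'rV[R]_m) (D beta : R) (F : 'rV[R]_m -> T -> R) (C E : T -> R) :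
  A !=set0 -> 0 < D -> (forall x, A x -> enorm (x - x0) <= D) ->
  0 < beta ->
  (forall x, A x -> measurable_fun setT (F x)) -> measurable_fun setT E ->
  (forall z, 0 <= C z) ->
  (forall z x y, A x -> A y ->
     `|F x z - F y z| <= C z * enorm (x - y) `^ beta) ->
  (forall z, C z * D `^ beta <= E z) ->
  forall eps, 0 < eps -> eps <= 2^-1 ->
  (entropy_integral [set F x | x in A] E eps <=
   (2 * eps * Num.sqrt ((3 * m + 1)%:R * ln 2 + m%:R / beta * ln (2 / eps)))%:E)%E.
Proof.
move=> A0 D0 AD beta0 mF mE C0 F_holder CE eps eps0 eps_le.
set a := _ * ln 2; set b := m%:R / beta.
have b0 : 0 <= b by rewrite divr_ge0// ltW.
(* This is [ln (1 + x) <= x] at [x = - 1 / 2]. *)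
have ln2_ge : 2^-1 <= ln (2 : R).
  have := @le_ln1Dx R (- 2^-1); rewrite (_ : 1 + - 2^-1 = 2^-1); last by lra.
  by rewrite lnV ?posrE//; lra.
have b_le : b <= a + b * ln (2 / eps).
  have a0 : 0 <= a by rewrite mulr_ge0//; lra.
  (* Here [eps <= 1 / 2] enters: [2 / eps >= 4] and [ln 4 = 2 ln 2 >= 1]. *)
  suff : 1 <= ln (2 / eps).
    by move=> h; rewrite -[leLHS]add0r lerD// ler_peMr.
  apply: (@le_trans _ _ (ln (2 ^+ 2))).
    by rewrite lnXn// -(mulr_natl (ln 2)); lra.
  rewrite ler_ln ?posrE ?divr_gt0// ler_pdivlMr//; lra.
apply: le_trans (@integral_dyadic_le R _ eps (sqrtr_ge0 _) eps0).
apply: le_integral_nonmeasurable => s /=; rewrite in_itv/= => /andP[s0 s_eps].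
  rewrite adde_ge0 ?lee_fin ?sqrtr_ge0// mule_ge0 ?lee_fin ?divr_ge0 ?sqrtr_ge0//.
  by apply: nneseries_ge0 => j _ _; rewrite lee_fin.
apply: le_trans (@sqrt_ln_le_dyadic R a b eps s b0 eps0 s0 s_eps b_le).
apply: ge_ereal_sup => _ [Q _ <-].
by apply: (sqrt_lne_covering_le A x0 D beta F C E) => //; lra.
Qed.

(** * Euclidean diameter and closure in the sup-norm topology *)

Lemma enorm_le_norm (R : realType) (m : nat) (x : 'rV[R]_m) :
  enorm x <= m%:R * `|x|.
Proof.
apply: enorm_le_coord => // i; rewrite [leRHS]/Num.norm/= mx_normrE.
exact: (le_bigmax _ (fun i : 'I_1 * 'I_m => `|x i.1 i.2|) (ord0, i)).
Qed.

(** Compactness bounds the set of distances, so [sup] is a genuine upper bound and not its default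
    value. *)
Lemma enorm_le_ediam (R : realType) (m : nat) (A : set 'rV[R]_m) x y :
  compact A -> A x -> A y -> enorm (x - y) <= ediam A.
Proof.
move=> /compact_bounded[M [_ AM]] Ax Ay; apply: ub_le_sup; last first.
  by exists x => //; exists y.
exists (m%:R * ((M + 1) + (M + 1))) => _ [u Au [v Av <-]].
apply: (le_trans (enorm_le_norm _ _ _)); rewrite ler_wpM2l//.
by apply: (le_trans (ler_normB _ _)); rewrite lerD// AM ?ltrDl.
Qed.

Lemma closure_enorm (R : realType) (m : nat) (A : set 'rV[R]_m) x (e : R) :
  closure A x -> 0 < e -> exists2 y, A y & enorm (x - y) <= e.
Proof.
(* A sup-norm ball of radius [e / (m + 1)] fits into the Euclidean ball of radius [e], also for
   [m = 0]. *)
move=> Ax e0; have e'0 : 0 < e / m.+1%:R by rewrite divr_gt0.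
have [y [Ay]] := Ax _ (nbhsx_ballx x _ e'0).
rewrite mx_norm_ball => xy; exists y => //.
apply: (le_trans (enorm_le_norm _ _ _)).
apply: (@le_trans _ _ (m%:R * (e / m.+1%:R))); first by rewrite ler_wpM2l// ltW.
by rewrite mulrCA ler_piMr ?ltW// ltr_pdivrMr// mul1r ltr_nat.
Qed.

(** * Square integrability and approximation from a dense subset *)

Section square_integrable.
Context {d : measure_display} {T : measurableType d} {R : realType}.
Variable P : probability T R.
Implicit Types f g : T -> R.

Lemma Lfun2_measurable f : f \in Lfun P 2%:E -> measurable_fun setT f.
Proof. by move/sub_Lfun_mfun; rewrite inE. Qed.

Lemma Lfun2_add f g : f \in Lfun P 2%:E -> g \in Lfun P 2%:E ->
  (fun z => f z + g z) \in Lfun P 2%:E.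
Proof.
have p1 : (1 <= 2%:E :> \bar R)%E by rewrite lee_fin ler1n.
exact: (Lfun_addr_closed P p1).2.
Qed.

Lemma Lfun2_abs f : f \in Lfun P 2%:E -> (fun z => `|f z|) \in Lfun P 2%:E.
Proof.
move=> /[dup] /Lfun2_measurable mf /sub_Lfun_finLfun; rewrite !inE/= => ff.
apply/andP; split; rewrite inE/=; first exact: measurableT_comp.
by move: ff; rewrite /finite_norm -Lnorm_abse.
Qed.

Lemma Lfun2_scale f (a : R) : f \in Lfun P 2%:E ->
  (fun z => f z * a) \in Lfun P 2%:E.
Proof. by move=> fL; apply: Lfun_scale => //; rewrite ler1n. Qed.

End square_integrable.

(** On a probability space [L^2] is contained in [L^1]; a change of variables carries this from the
    distribution of [Z] to [Omega]. *)
Lemma ge0_expectation_lty (d d' : measure_display) (Omega : measurableType d)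
    (T : measurableType d') (R : realType) (P : probability Omega R)
    (Z : {RV P >-> T}) (C : T -> R) : (forall z, 0 <= C z) ->
  C \in Lfun (distribution P Z) 2%:E -> (\int[P]_w (C (Z w))%:E < +oo)%E.
Proof.
move=> C0 CL.
have -> : (\int[P]_w (C (Z w))%:E = \int[distribution P Z]_z (C z)%:E)%E.
  rewrite ge0_integral_distribution//.
  by apply/measurable_EFinP; exact: Lfun2_measurable CL.
have PT : distribution P Z setT \is a fin_num by rewrite probability_setT.
have /Lfun1_integrable/integrableP[_] := Lfun_subset12 PT CL.
congr (_ < _)%E; apply: eq_integral => z _.
by rewrite /= ger0_norm.
Qed.

(** The Hölder condition bounds both terms by a constant, depending on the sample, times
    [enorm (x - y) ^ beta], which density makes arbitrarily small. The argument works at every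
    sample point [z]. *)
Lemma ereal_inf_holder_dense (R : realType) (m n : nat)
    (dO d : measure_display) (Omega : measurableType dO)
    (T : measurableType d) (P : probability Omega R) (Z : {RV P >-> T})
    (A D : set 'rV[R]_m) (G : 'rV[R]_m -> T -> R) (beta : R) (C : T -> R)
    (x : 'rV[R]_m) (z : n.-tuple T) :
  0 < beta -> (forall t, 0 <= C t) -> C \in Lfun (distribution P Z) 2%:E ->
  (forall t u v, A u -> A v -> `|G u t - G v t| <= C t * enorm (u - v) `^ beta) ->
  (forall u, A u -> measurable_fun setT (G u)) ->
  A x -> D `<=` A -> closure D x ->
  ereal_inf
    [set ('E_P [(fun w => `|G x (Z w) - G y (Z w)|)%R] +
          ((\big[Num.max/0]_(j < n)
             `|G x (tnth z j) - G y (tnth z j)|)%R)%:E)%E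
    | y in D] = 0%E.
Proof.
move=> beta0 C0 CL GC mG Ax DA Dx; apply/eqP; rewrite eq_le; apply/andP; split.
  apply/lee_addgt0Pr => e e0; rewrite add0e.
  have mCZ : measurable_fun setT (fun w => C (Z w)).
    exact: measurableT_comp (Lfun2_measurable _ _ CL) _.
  have : (\int[P]_w (C (Z w))%:E)%E \is a fin_num.
    rewrite ge0_fin_numE ?ge0_expectation_lty//.
    by apply: integral_ge0 => w _; rewrite lee_fin.
  move=> /fineK; set c := fine _ => cE.
  have c0 : 0 <= c.
    by rewrite -lee_fin cE; apply: integral_ge0 => w _; rewrite lee_fin.
  (* The sum dominates the maximum over [j], and the added 1 makes [S] positive. The radius below
     solves [S * r ^ beta = e]. *)
  pose S := c + \sum_(j < n) C (tnth z j) + 1.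
  have S1 : 1 <= S by rewrite lerDr addr_ge0// sumr_ge0.
  have S0 : 0 < S by exact: lt_le_trans S1.
  pose r := (e / S) `^ beta^-1.
  have r0 : 0 < r by rewrite powR_gt0// divr_gt0.
  have [y Dy xy] := closure_enorm _ _ _ _ _ Dx r0.
  pose t := enorm (x - y) `^ beta.
  have t0 : 0 <= t by exact: powR_ge0.
  have tS : S * t <= e.
    rewrite mulrC -ler_pdivlMr//.
    have <- : r `^ beta = e / S.
      by rewrite /r -powRrM mulVf ?lt0r_neq0// powRr1// divr_ge0// ltW.
    by rewrite ge0_ler_powR// ?nnegrE ?enorm_ge0// ltW.
  have Ay := DA y Dy.
  apply: ge_ereal_inf; eexists; first by exists y.
  apply: (@le_trans _ _ ((t * c)%:E + ((\sum_(j < n) C (tnth z j)) * t)%:E)%E).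
    apply: leeD.
      rewrite unlock EFinM cE -ge0_integralZl//; last 2 first.
      - exact/measurable_EFinP.
      - by move=> w _; rewrite lee_fin.
      apply: ge0_le_integral => //.
      - apply/measurable_EFinP; apply: measurableT_comp => //.
        by apply: measurable_funB; apply: measurableT_comp => //; exact: mG.
      - exact/measurable_funeM/measurable_EFinP.
      - by move=> w _; rewrite -EFinM lee_fin mulrC GC.
    rewrite lee_fin; apply: bigmax_le => [|j _].
      by rewrite mulr_ge0// sumr_ge0.
    apply: (le_trans (GC _ _ _ Ax Ay)); rewrite ler_wpM2r//.
    by rewrite (bigD1 j)//= lerDl sumr_ge0.
  rewrite -EFinD lee_fin (le_trans _ tS)// mulrC -mulrDl ler_wpM2r//.
  by rewrite /S lerDl.
apply: le_ereal_inf_tmp => _ [y _ <-]; rewrite adde_ge0//.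
  by rewrite unlock integral_ge0// => w _; rewrite lee_fin.
by rewrite lee_fin bigmax_ge_id.
Qed.

(** * Both claims assembled *)

Theorem proposition5p1
  (R : realType) (m d : nat)
  (dO : measure_display) (Omega : measurableType dO) (P : probability Omega R)
  (Z1 : {RV P >-> d.-tuple R})
  (Theta : set 'rV[R]_m) (G : 'rV[R]_m -> d.-tuple R -> R)
  (thstar thbar : 'rV[R]_m) (beta : R) (C : d.-tuple R -> R)
  (Theta_compact : compact Theta)
  (Theta_diam : 0 < ediam Theta)
  (thstar_in : Theta thstar)
  (beta_gt0 : 0 < beta) (beta_le1 : beta <= 1)
  (C_gt0 : forall z, 0 < C z)
  (C_sqint : C \in Lfun (distribution P Z1) 2%:E)
  (G_holder : forall z th vt, Theta th -> Theta vt ->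
     `|G th z - G vt z| <= C z * enorm (th - vt) `^ beta)
  (G_meas : forall th, Theta th -> measurable_fun setT (G th))
  (thbar_in : Theta thbar)
  (Gbar_sqint : G thbar \in Lfun (distribution P Z1) 2%:E) :
  let PZ : probability (d.-tuple R) R := distribution P Z1 in
  let U := eball_in Theta thstar in
  let FTheta := [set G th | th in Theta] in
  let FThetad (delta : R) :=
    [set (fun z => G th z - G thstar z) | th in U delta] in
  let xi := fun z => C z * ediam Theta `^ beta + `|G thbar z| in
  let xid (delta : R) := fun z => C z * (2 `^ beta) * (delta `^ beta) in
  let bound (eps : R) :=
    2 * eps * Num.sqrt ((3 * m + 1)%:R * ln 2 + m%:R / beta * ln (2 / eps)) in
  ([/\ positive_envelope FTheta xi,
       xi \in Lfun PZ 2%:E,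
       (forall eps : R, 0 < eps -> eps <= 2^-1 ->
          (entropy_integral FTheta xi eps <= (bound eps)%:E)%E)
     & forall (delta : R) (D : set 'rV[R]_m), 0 < delta ->
         countable D -> D `<=` U delta -> U delta `<=` closure D ->
         exists N : forall n : nat, set (n.-tuple (d.-tuple R)),
           (forall n, (0 < n)%N -> (power_probability PZ n).-negligible (N n)) /\
           (forall th n (z : n.-tuple (d.-tuple R)), U delta th -> (0 < n)%N ->
              ~ N n z ->
              ereal_inf
                [set ('E_P [(fun w => `|G th (Z1 w) - G vt (Z1 w)|)%R] +
                      ((\big[Num.max/0]_(j < n)
                         `|G th (tnth z j) - G vt (tnth z j)|)%R)%:E)%E
                | vt in D] = 0%E)])
  /\
  (forall delta : R, 0 < delta ->
     [/\ positive_envelope (FThetad delta) (xid delta),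
         xid delta \in Lfun PZ 2%:E
       & forall eps : R, 0 < eps -> eps <= 2^-1 ->
           (entropy_integral (FThetad delta) (xid delta) eps
              <= (bound eps)%:E)%E]).

Proof.
move=> PZ U FTheta FThetad xi xid bound.
have mC := Lfun2_measurable _ _ C_sqint.
have C_ge0 z : 0 <= C z by exact: ltW.
have U_Theta delta : U delta `<=` Theta by move=> th [].
have diam_pow : 0 < ediam Theta `^ beta by exact: powR_gt0.
split.
  have xi_Lfun : xi \in Lfun PZ 2%:E.
    by apply: Lfun2_add; [exact: Lfun2_scale|exact: Lfun2_abs].
  split=> //.
  - split.
    + by move=> _ [th Th <-]; exact: G_meas.
    + exact: Lfun2_measurable xi_Lfun.
    + by move=> z; rewrite ltr_pwDl// mulr_gt0.
    + move=> _ [th Th <-] z; rewrite -[G th z](subrK (G thbar z)).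
      apply: (le_trans (ler_normD _ _)); rewrite lerD2r.
      apply: (le_trans (G_holder z th thbar Th thbar_in)).
      rewrite ler_wpM2l// ge0_ler_powR ?nnegrE ?enorm_ge0//; [exact: ltW..|].
      exact: enorm_le_ediam.
  - apply: (entropy_integral_holder_le _ _ _ _ _ thstar (ediam Theta) _ _ C) => //.
    + by exists thstar.
    + by move=> th Th; exact: enorm_le_ediam.
    + exact: Lfun2_measurable xi_Lfun.
    + by move=> z; rewrite lerDl.
  (* The approximation holds at every sample point, so the exceptional sets can be empty. *)
  - move=> delta D delta0 cD DU UD; exists (fun=> set0); split=> [n _|].
      exact: negligible_set0.
    move=> th n z Uth _ _.
    apply: (ereal_inf_holder_dense _ _ _ _ _ _ _ _ _ (U delta) _ _ beta C) => //.
    + by move=> t u v /U_Theta Tu /U_Theta Tv; exact: G_holder.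
    + by move=> u /U_Theta; exact: G_meas.
    + exact: UD.
move=> delta delta0.
have xid_Lfun : xid delta \in Lfun PZ 2%:E by do 2 apply: Lfun2_scale.
have Ustar : U delta thstar.
  by split=> //; rewrite subrr -(scale0r 0) enormZ normr0 mul0r ltW.
(* The radius [2 * delta], larger than that of the ball, reproduces the prescribed envelope
   exactly. *)
have pow2d : (2 * delta) `^ beta = 2 `^ beta * delta `^ beta.
  by rewrite powRM// ltW.
have U_le th : U delta th -> enorm (th - thstar) <= 2 * delta.
  by move=> [_ /le_trans]; apply; lra.
split=> //.
- split.
  + move=> _ [th /U_Theta Th <-].
    by apply: measurable_funB; exact: G_meas.
  + exact: Lfun2_measurable xid_Lfun.
  + by move=> z; rewrite !mulr_gt0// powR_gt0.
  + move=> _ [th Uth <-] z.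
    apply: (le_trans (G_holder z th thstar (U_Theta _ _ Uth) thstar_in)).
    rewrite /xid -mulrA -pow2d ler_wpM2l// ge0_ler_powR ?nnegrE ?enorm_ge0//.
    * exact: ltW.
    * by rewrite mulr_ge0// ltW.
    * exact: U_le.
- apply: (entropy_integral_holder_le _ _ _ _ _ thstar (2 * delta) _
    (fun th z => G th z - G thstar z) C) => //.
  + by exists thstar.
  + by rewrite mulr_gt0.
  + move=> th /U_Theta Th; apply: measurable_funB; exact: G_meas.
  + exact: Lfun2_measurable xid_Lfun.
  + move=> z th vt /U_Theta Tth /U_Theta Tvt.
    (* The common term [G thstar z] cancels in differences, so centering preserves the Hölder
       condition. *)
    by rewrite opprB addrA subrK; exact: G_holder.
  + by move=> z; rewrite /xid pow2d mulrA.
Qed.
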